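(* Let $R$ be a Noetherian ring and let $I\subset R$ be a proper ideal. If $I$ satisfies the strong persistence property, then $I$ satisfies the persistence property, i.e. $$\operatorname{Ass}(I)\subset \operatorname{Ass}(I^2)\subset\cdots\subset \operatorname{Ass}(I^k)\subset\cdots.$$
   Context: Rings are commutative with unit. For an ideal $J\subset R$, $V(J)$ denotes the set of prime ideals of $R$ containing $J$, and $\operatorname{Ass}(J)$ denotes the set of associated prime ideals of the $R$-module $R/J$. For $P\in\operatorname{Spec}(R)$, $\mathfrak m_P$ denotes the maximal ideal of the local ring $R_P$, and $I_P=IR_P$. Let $P\in V(I)$. The ideal $I$ satisfies the strong persistence property with respect to $P$ if for all integers $k\ge 1$ and all $f\in (I_P^k:\mathfrak m_P)\setminus I_P^k$ there exists $g\in I_P$ such that $fg\notin I_P^{k+1}$. The ideal $I$ satisfies the strong persistence property if it satisfies the strong persistence property with respect to every $P\in V(I)$. *)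

(* Defs.v *)
From HB Require Import structures.
From mathcomp Require Import all_boot all_algebra boolp ring.

Set Implicit Arguments.
Unset Strict Implicit.
Unset Printing Implicit Defensive.

Import GRing.Theory.
Local Open Scope ring_scope.
Local Open Scope quotient_scope.

(* Ideals are boolean predicates, as in ring_quotient: an [idealr R] is a
   proper ideal and a [prime_idealr R] a prime ideal.  The operations below
   are decided classically, so no decidability assumption is hidden in them. *)

Section IdealOperations.
Variable R : comNzRingType.
Implicit Types A B J K : {pred R}.

Definition ideal_span A : {pred R} := fun x =>
  `[< exists s : seq (R * R),
        {in s, forall p, p.2 \in A} /\ x = \sum_(p <- s) p.1 * p.2 >].

Definition ideal_mul A B : {pred R} :=
  ideal_span (fun x => `[< exists2 a, a \in A & exists2 b, b \in B & x = a * b >]).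

(* The zeroth power is the unit ideal. *)
Definition ideal_exp A (k : nat) : {pred R} := iter k (ideal_mul A) predT.

Definition ideal_colon J K : {pred R} := fun x =>
  `[< forall y, y \in K -> x * y \in J >].

Lemma ideal_spanP A x :
  reflect (exists s : seq (R * R),
             {in s, forall p, p.2 \in A} /\ x = \sum_(p <- s) p.1 * p.2)
          (x \in ideal_span A).
Proof. exact: asboolP. Qed.

Lemma ideal_span_closed A : GRing.submod_closed (ideal_span A : {pred R^o}).
Proof.
split=> [|a u v /ideal_spanP[s [sA ->]] /ideal_spanP[t [tA ->]]].
  by apply/ideal_spanP; exists [::]; rewrite big_nil.
apply/ideal_spanP; exists ([seq (a * p.1, p.2) | p <- s] ++ t); split=> [p|].
  by rewrite mem_cat => /orP[/mapP[q /sA qA ->]|/tA].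
rewrite big_cat big_map /=; congr (_ + _).
by rewrite /GRing.scale /= mulr_sumr; apply: eq_bigr => p _; rewrite mulrA.
Qed.

Lemma ideal_span_sub A (J : idealr R) :
  {subset A <= J} -> {subset ideal_span A <= J}.
Proof.
move=> AJ x /ideal_spanP[s [sA ->]]; rewrite big_seq.
by apply: rpred_sum => p /sA /AJ; apply: idealMr.
Qed.

Lemma ideal_expS_idealr_closed (I : idealr R) (k : nat) :
  idealr_closed (ideal_exp I k.+1).
Proof.
have [s0 sD] := ideal_span_closed
  (fun x => `[< exists2 a, a \in I & exists2 b, b \in ideal_exp I k & x = a * b >]).
split=> //.
apply/negP => /(@ideal_span_sub _ I); rewrite idealr1 => /(_ _)/wrap[]//.
by move=> x /asboolP[a Ia [b _ ->]]; rewrite mulrC idealMr.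
Qed.

(* Positive powers of a proper ideal are proper ideals. *)
HB.instance Definition _ (I : idealr R) (k : nat) :=
  isIdealr.Build R (ideal_exp I k.+1) (ideal_expS_idealr_closed I k).

(* Arbitrary (possibly improper) ideals are the submodules of R^o. *)
Definition noetherian : Prop :=
  forall J : {pred R^o}, GRing.submod_closed J ->
    exists s : seq R, J =i ideal_span [in s].

End IdealOperations.

Section QuotientModule.
Variables (R : comNzRingType) (J : idealr R).
Local Notation Q := {ideal_quot J}.

Definition quot_scale (a : R) (q : Q) : Q := \pi_Q a * q.

Fact quot_scaleA a b q : quot_scale a (quot_scale b q) = quot_scale (a * b) q.
Proof. by rewrite /quot_scale rmorphM mulrA. Qed.

Fact quot_scale1 : left_id 1 quot_scale.
Proof. by move=> q; rewrite /quot_scale rmorph1 mul1r. Qed.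

Fact quot_scaleDr : right_distributive quot_scale +%R.
Proof. by move=> a q r; rewrite /quot_scale mulrDr. Qed.

Fact quot_scaleDl q : {morph quot_scale^~ q : a b / a + b}.
Proof. by move=> a b; rewrite /quot_scale rmorphD mulrDl. Qed.

HB.instance Definition _ := GRing.Zmodule_isLmodule.Build R Q
  quot_scaleA quot_scale1 quot_scaleDr quot_scaleDl.

End QuotientModule.

Definition associated_prime (R : comNzRingType) (M : lmodType R)
    (P : prime_idealr R) : Prop :=
  exists m : M, forall a : R, (a \in P) = (a *: m == 0).

Definition Ass (R : comNzRingType) (J : idealr R) (P : prime_idealr R) : Prop :=
  associated_prime {ideal_quot J} P.

(* The localization of R at P: fractions a/s with s outside P, where
   a/s = b/t iff u * a * t = u * b * s for some u outside P. *)

Section Fractions.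
Variables (R : comNzRingType) (P : prime_idealr R).

Record loc_frac := LocFrac { loc_pair :> R * R; _ : loc_pair.2 \notin P }.

HB.instance Definition _ := [isSub for loc_pair].
HB.instance Definition _ := [Choice of loc_frac by <:].

End Fractions.

Module Localization.
Section Localization.
Variables (R : comNzRingType) (P : prime_idealr R).
Local Notation frac := (loc_frac P).
Implicit Types x y z : frac.

Lemma denP x : x.2 \notin P. Proof. by case: x. Qed.

Lemma mulP s t : s \notin P -> t \notin P -> s * t \notin P.
Proof. by move=> sP tP; rewrite prime_idealrM negb_or sP. Qed.

Lemma oneP : 1 \notin P. Proof. by rewrite idealr1. Qed.

Definition equivl x y : bool :=
  `[< exists2 u, u \notin P & u * x.1 * y.2 = u * y.1 * x.2 >].

Lemma equivl_refl : reflexive equivl.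
Proof. by move=> x; apply/asboolP; exists 1 => //; apply: oneP. Qed.

Lemma equivl_sym : symmetric equivl.
Proof. by move=> x y; apply/asboolP/asboolP => -[u uP e]; exists u. Qed.

Lemma equivl_trans : transitive equivl.
Proof.
move=> y x z /asboolP[u uP exy] /asboolP[v vP eyz]; apply/asboolP.
exists (u * v * y.2); first by rewrite !mulP ?denP.
transitivity (v * z.2 * (u * x.1 * y.2)); first by ring.
rewrite exy; transitivity (u * x.2 * (v * y.1 * z.2)); first by ring.
by rewrite eyz; ring.
Qed.

Canonical equivl_equiv := EquivRel equivl equivl_refl equivl_sym equivl_trans.

Definition type := {eq_quot equivl}.
HB.instance Definition _ : EqQuotient _ equivl type := EqQuotient.on type.
HB.instance Definition _ := Choice.on type.

Lemma repr_piP x : exists2 u, u \notin P &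
  u * (repr (\pi_type x)).1 * x.2 = u * x.1 * (repr (\pi_type x)).2.
Proof. by have /eqmodP/asboolP := reprK (\pi_type x). Qed.

Definition addf x y : frac :=
  @LocFrac _ P (x.1 * y.2 + y.1 * x.2, x.2 * y.2) (mulP (denP x) (denP y)).
Definition oppf x : frac := @LocFrac _ P (- x.1, x.2) (denP x).
Definition mulf x y : frac :=
  @LocFrac _ P (x.1 * y.1, x.2 * y.2) (mulP (denP x) (denP y)).
Definition embf (a : R) : frac := @LocFrac _ P (a, 1) oneP.

Definition add := lift_op2 type addf.
Definition opp := lift_op1 type oppf.
Definition mul := lift_op2 type mulf.
Definition emb (a : R) : type := \pi_type (embf a).

Lemma pi_add : {morph \pi_type : x y / addf x y >-> add x y}.
Proof.
move=> x y; unlock add; apply/eqmodP; rewrite /= equivl_sym; apply/asboolP => /=.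
have [u uP ex] := repr_piP x; have [v vP ey] := repr_piP y.
move: (repr (\pi x)) (repr (\pi y)) ex ey => x' y' ex ey.
exists (u * v); rewrite ?mulP //=.
transitivity (v * y.2 * y'.2 * (u * x'.1 * x.2)
            + u * x.2 * x'.2 * (v * y'.1 * y.2)); first by ring.
by rewrite ex ey; ring.
Qed.

Lemma pi_opp : {morph \pi_type : x / oppf x >-> opp x}.
Proof.
move=> x; unlock opp; apply/eqmodP; rewrite /= equivl_sym; apply/asboolP => /=.
have [u uP ex] := repr_piP x; exists u => //=.
by rewrite !mulrN !mulNr ex.
Qed.

Lemma pi_mul : {morph \pi_type : x y / mulf x y >-> mul x y}.
Proof.
move=> x y; unlock mul; apply/eqmodP; rewrite /= equivl_sym; apply/asboolP => /=.
have [u uP ex] := repr_piP x; have [v vP ey] := repr_piP y.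
move: (repr (\pi x)) (repr (\pi y)) ex ey => x' y' ex ey.
exists (u * v); rewrite ?mulP //=.
transitivity ((u * x'.1 * x.2) * (v * y'.1 * y.2)); first by ring.
by rewrite ex ey; ring.
Qed.

Lemma pi_eq x y : x.1 * y.2 = y.1 * x.2 -> \pi_type x = \pi_type y.
Proof.
move=> e; apply/eqmodP/asboolP; exists 1; first exact: oneP.
by rewrite !mul1r.
Qed.

Fact addA : associative add.
Proof.
elim/quotW=> x; elim/quotW=> y; elim/quotW=> z; rewrite -!pi_add.
by apply: pi_eq => /=; ring.
Qed.

Fact addC : commutative add.
Proof.
by elim/quotW=> x; elim/quotW=> y; rewrite -!pi_add; apply: pi_eq => /=; ring.
Qed.

Fact add0 : left_id (emb 0) add.
Proof. by elim/quotW=> x; rewrite -!pi_add; apply: pi_eq => /=; ring. Qed.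

Fact addN : left_inverse (emb 0) opp add.
Proof.
by elim/quotW=> x; rewrite -pi_opp -!pi_add; apply: pi_eq => /=; ring.
Qed.

HB.instance Definition _ := GRing.isZmodule.Build type addA addC add0 addN.

Fact mulA : associative mul.
Proof.
elim/quotW=> x; elim/quotW=> y; elim/quotW=> z; rewrite -!pi_mul.
by apply: pi_eq => /=; ring.
Qed.

Fact mulC : commutative mul.
Proof.
by elim/quotW=> x; elim/quotW=> y; rewrite -!pi_mul; apply: pi_eq => /=; ring.
Qed.

Fact mul1 : left_id (emb 1) mul.
Proof. by elim/quotW=> x; rewrite -!pi_mul; apply: pi_eq => /=; ring. Qed.

Fact mulDl : left_distributive mul add.
Proof.
elim/quotW=> x; elim/quotW=> y; elim/quotW=> z; rewrite -pi_add -!pi_mul -pi_add.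
by apply: pi_eq => /=; ring.
Qed.

Fact one_neq0 : emb 1 != 0 :> type.
Proof.
apply/negP => /eqP/eqmodP/asboolP[u uP] /=.
by rewrite !mulr1 mulr0 => u0; rewrite u0 idealr0 in uP.
Qed.

HB.instance Definition _ :=
  GRing.Zmodule_isComNzRing.Build type mulA mulC mul1 mulDl one_neq0.

Fact emb_is_zmod_morphism : zmod_morphism emb.
Proof.
move=> a b; rewrite /emb -[X in _ = _ + X]pi_opp -[RHS]pi_add.
by apply: pi_eq => /=; ring.
Qed.

Fact emb_is_monoid_morphism : monoid_morphism emb.
Proof.
split=> // a b; rewrite /emb -[RHS]pi_mul.
by apply: pi_eq => /=; ring.
Qed.

HB.instance Definition _ := GRing.isZmodMorphism.Build R type emb
  emb_is_zmod_morphism.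
HB.instance Definition _ := GRing.isMonoidMorphism.Build R type emb
  emb_is_monoid_morphism.

End Localization.
End Localization.
HB.export Localization.

Definition localization (R : comNzRingType) (P : prime_idealr R) : comNzRingType :=
  Localization.type P.

Definition to_loc (R : comNzRingType) (P : prime_idealr R) :
  {rmorphism R -> localization P} := @Localization.emb R P.

Arguments to_loc {R} P.

Definition loc_ideal (R : comNzRingType) (P : prime_idealr R) (J : {pred R}) :
    {pred localization P} :=
  ideal_span (fun y => `[< exists2 x, x \in J & y = to_loc P x >]).

Arguments loc_ideal {R} P J.

Definition loc_max (R : comNzRingType) (P : prime_idealr R) :
  {pred localization P} := loc_ideal P P.

Arguments loc_max {R} P.

(* [loc_max P] consists of the non-units, hence it is the maximal ideal of the
   local ring [localization P]. *)
Lemma loc_maxE (R : comNzRingType) (P : prime_idealr R) (x : localization P) :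
  x \notin loc_max P <-> exists y : localization P, x * y = 1.
Proof.
elim/quotW: x => x; split=> [xm | [y xy1]].
  have x1P : x.1 \notin P.
    apply: contra xm => x1P.
    have -> : \pi_(localization P) x
            = \pi_(localization P) (@LocFrac _ P (1, x.2) (Localization.denP x)) * to_loc P x.1.
      by rewrite -[RHS]Localization.pi_mul; apply: Localization.pi_eq => /=; ring.
    apply/ideal_spanP; eexists [:: (_, to_loc P x.1)]; rewrite big_seq1.
    by split=> // p; rewrite inE => /eqP->; apply/asboolP; exists x.1.
  exists (\pi_(localization P) (@LocFrac _ P (x.2, x.1) x1P)).
  by rewrite -[LHS]Localization.pi_mul; apply: Localization.pi_eq => /=; ring.
apply/negP => /ideal_spanP[s [sP xs]].
have [f fP xf] : exists2 f : loc_frac P, f.1 \in P & \pi_(localization P) x =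
    \pi_(localization P) f.
  rewrite xs big_seq; elim/big_ind: _ => [|_ _ [f fP ->] [g gP ->]|p /sP].
  - by exists (Localization.embf P 0); rewrite //= idealr0.
  - exists (Localization.addf f g); last exact/esym/Localization.pi_add.
    by rewrite /= rpredD // mulrC idealMr.
  - case: p => [c b] /= /asboolP[a aP ->]; elim/quotW: c => c.
    exists (Localization.mulf c (Localization.embf P a)).
      by rewrite /= idealMr.
    exact/esym/Localization.pi_mul.
move: xy1; rewrite xf; elim/quotW: y => y.
rewrite -[LHS]Localization.pi_mul => /eqmodP/asboolP[u uP] /=.
rewrite !mulr1 => e; have: u * (f.2 * y.2) \in P.
  by rewrite -e idealMr // mulrC idealMr.
by apply/negP; rewrite !Localization.mulP ?Localization.denP.
Qed.

Definition strong_persistence_at (R : comNzRingType) (I : idealr R)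
    (P : prime_idealr R) : Prop :=
  let IP := loc_ideal P I in
  forall k : nat, (1 <= k)%N ->
  forall f : localization P,
    f \in ideal_colon (ideal_exp IP k) (loc_max P) -> f \notin ideal_exp IP k ->
    exists2 g : localization P, g \in IP & f * g \notin ideal_exp IP k.+1.

Definition strong_persistence (R : comNzRingType) (I : idealr R) : Prop :=
  forall P : prime_idealr R, {subset I <= P} -> strong_persistence_at I P.

(* The index is shifted: [k] ranges over all naturals, the exponents
   being [k + 1 >= 1]. *)
Definition persistence (R : comNzRingType) (I : idealr R) : Prop :=
  forall (k : nat) (P : prime_idealr R),
    Ass (ideal_exp I k.+1) P -> Ass (ideal_exp I k.+2) P.

(* Main.v *)
Require Import Defs.
From mathcomp Require Import all_boot all_algebra.
From mathcomp Require Import boolp ring.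

Set Implicit Arguments.
Unset Strict Implicit.
Unset Printing Implicit Defensive.

Import GRing.Theory.
Local Open Scope ring_scope.
Local Open Scope quotient_scope.

(** If P = (I^k : m), then m/1 lies in (I_P^k : m_P) but not in I_P^k, so
    strong persistence at P gives g in I_P with (m/1) g outside I_P^(k+1).
    Clearing the denominator of g replaces it by some a in I.  Then
    P a m is contained in a I^k, hence in I^(k+1), while s a m in I^(k+1)
    with s outside P would put (m/1) g back into I_P^(k+1); therefore
    P = (I^(k+1) : a m). *)

Section IdealPowers.
Variable R : comNzRingType.
Implicit Types (A J : {pred R}) (a b c x y : R) (k : nat).

Lemma mem_ideal_span A x : x \in A -> x \in ideal_span A.
Proof.
move=> Ax; apply/ideal_spanP; exists [:: (1, x)].
by rewrite big_seq1 mul1r; split=> // p; rewrite inE => /eqP->.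
Qed.

Lemma ideal_span_ind A (K : R -> Prop) :
    K 0 -> (forall x y, K x -> K y -> K (x + y)) ->
    (forall c a, a \in A -> K (c * a)) ->
  forall x, x \in ideal_span A -> K x.
Proof.
move=> K0 KD KM x /ideal_spanP[s [sA ->]]; rewrite big_seq.
by elim/big_ind: _ => // p /sA; apply: KM.
Qed.

(** [J] may be any predicate: the zeroth power is the whole ring, and every later power is a span by
    construction. *)
Lemma ideal_exp_closed J k :
  GRing.submod_closed (ideal_exp J k : {pred R^o}).
Proof. by case: k => [|k] //; apply: ideal_span_closed. Qed.

Lemma ideal_expMl J k c x : x \in ideal_exp J k -> c * x \in ideal_exp J k.
Proof.
by have [J0 JD] := ideal_exp_closed J k; move=> Jx; rewrite -[c * x]addr0 JD.
Qed.

Lemma ideal_expSM J k a b :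
  a \in J -> b \in ideal_exp J k -> a * b \in ideal_exp J k.+1.
Proof.
by move=> Ja Jb; apply/mem_ideal_span/asboolP; exists a => //; exists b.
Qed.

Lemma ideal_expX J k a : a \in J -> a ^+ k \in ideal_exp J k.
Proof. by move=> Ja; elim: k => // k IHk; rewrite exprS ideal_expSM. Qed.

Lemma prime_idealrX (P : prime_idealr R) a k : a ^+ k \in P -> a \in P.
Proof.
elim: k => [|k IHk]; first by rewrite idealr1.
by rewrite exprS prime_idealrM => /orP[|/IHk].
Qed.

(** Lifting an element of R/J to a representative [m] turns its annihilator into the colon ideal (J
    : m), so quotient modules can be left behind. *)
Lemma AssP (J : idealr R) (P : prime_idealr R) :
  Ass J P <-> exists m, forall a, (a \in P) = (a * m \in J).
Proof.
have scaleE a m : (a *: \pi_{ideal_quot J} m == 0) = (a * m \in J).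
  rewrite [_ *: _](_ : _ = \pi_{ideal_quot J} (a * m)); last by rewrite rmorphM.
  by rewrite -(rmorph0 (\pi_{ideal_quot J})) -Quotient.idealrBE subr0.
split=> [[q] | [m mP]]; last by exists (\pi m) => a; rewrite scaleE.
by elim/quotW: q => m mP; exists m => a; rewrite mP scaleE.
Qed.

End IdealPowers.

Section LocalizedIdeals.
Variables (R : comNzRingType) (P : prime_idealr R).
Implicit Types (J : {pred R}) (a b s t : R) (x y z : localization P).

Lemma to_loc_inv s : s \notin P -> exists z, to_loc P s * z = 1.
Proof.
move=> sP; exists (\pi_(localization P) (@LocFrac _ P (1, s) sP)).
by rewrite -[LHS]Localization.pi_mul; apply: Localization.pi_eq => /=; ring.
Qed.

Lemma loc_denominator y :
  exists2 s, s \notin P & exists a, y * to_loc P s = to_loc P a.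
Proof.
elim/quotW: y => y; exists y.2; first exact: Localization.denP.
exists y.1.
by rewrite -[LHS]Localization.pi_mul; apply: Localization.pi_eq => /=; ring.
Qed.

Lemma to_loc_eq a b :
  to_loc P a = to_loc P b -> exists2 u, u \notin P & u * a = u * b.
Proof.
by move=> /eqmodP/asboolP[u uP] /=; rewrite !mulr1 => e; exists u.
Qed.

(** For an ideal [J] this is membership in J R_P as a single fraction a/s, cleared of its
    denominator so that no representative of [y] is chosen. *)
Definition loc_numerator J y : Prop :=
  exists2 s, s \notin P & exists2 a, a \in J & y * to_loc P s = to_loc P a.

(** Sums are taken over the product of the denominators, and a factor [c] contributes its own
    denominator; hence fractions with numerator in [J] form an ideal. *)
Lemma loc_numerator_span J (A : {pred localization P}) :
    GRing.submod_closed (J : {pred R^o}) ->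
    (forall y, y \in A -> loc_numerator J y) ->
  forall y, y \in ideal_span A -> loc_numerator J y.
Proof.
move=> [J0 JD] AJ.
have JM c a : a \in J -> c * a \in J.
  by move=> Ja; rewrite -[c * a]addr0 JD.
apply: ideal_span_ind => [|x y [s sP [a Ja xs]] [t tP [b Jb yt]]|c y].
- by exists 1; rewrite ?idealr1 //; exists 0; rewrite // mul0r rmorph0.
- exists (s * t); first exact: Localization.mulP.
  exists (t * a + s * b); first by apply: JD => //; apply: JM.
  by rewrite rmorphD !rmorphM -xs -yt; ring.
- move=> /AJ[s sP [a Ja ys]]; have [t tP [b ct]] := loc_denominator c.
  exists (t * s); first exact: Localization.mulP.
  by exists (b * a); rewrite ?JM // !rmorphM -ct -ys; ring.
Qed.

Lemma loc_ideal_numerator J y : GRing.submod_closed (J : {pred R^o}) ->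
  y \in loc_ideal P J -> loc_numerator J y.
Proof.
move=> Jcl; apply: loc_numerator_span => // _ /asboolP[a Ja ->].
by exists 1; rewrite ?idealr1 //; exists a; rewrite // rmorph1 mulr1.
Qed.

Lemma loc_ideal_exp_numerator J k y : GRing.submod_closed (J : {pred R^o}) ->
  y \in ideal_exp (loc_ideal P J) k -> loc_numerator (ideal_exp J k) y.
Proof.
move=> Jcl; elim: k y => [|k IHk] y.
  (* At exponent zero both powers are unit ideals, so any numerator will do. *)
  by move=> _; have [s sP [a ya]] := loc_denominator y; exists s => //; exists a.
apply: loc_numerator_span; first exact: ideal_exp_closed.
move=> _ /asboolP[x Jx [z Jz ->]].
have [s sP [a Ja xs]] := loc_ideal_numerator Jcl Jx.
have [t tP [b Jb zt]] := IHk z Jz.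
exists (s * t); first exact: Localization.mulP.
by exists (a * b); rewrite ?ideal_expSM // !rmorphM -xs -zt; ring.
Qed.

Lemma to_loc_ideal_exp J k a :
  a \in ideal_exp J k -> to_loc P a \in ideal_exp (loc_ideal P J) k.
Proof.
elim: k a => [|k IHk] //.
apply: (ideal_span_ind (K := fun a => to_loc P a \in _)) => [|x y Jx Jy|c d].
- by rewrite rmorph0; have [] := ideal_exp_closed (loc_ideal P J) k.+1.
- have [_ JD] := ideal_exp_closed (loc_ideal P J) k.+1.
  by rewrite rmorphD -[to_loc P x]mul1r; apply: JD.
- move=> /asboolP[x Jx [y Jy ->]]; rewrite !rmorphM; apply: ideal_expMl.
  apply: ideal_expSM; last exact: IHk.
  by apply/mem_ideal_span/asboolP; exists x.
Qed.

(** The image of [s] is a unit, so [y] is a multiple of the image of [a]. *)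
Lemma mem_loc_ideal_exp J k y s a : s \notin P -> a \in ideal_exp J k ->
  y * to_loc P s = to_loc P a -> y \in ideal_exp (loc_ideal P J) k.
Proof.
move=> /to_loc_inv[z sz] Ja ys.
have -> : y = z * to_loc P a by rewrite -ys mulrCA [z * _]mulrC sz mulr1.
exact/ideal_expMl/to_loc_ideal_exp.
Qed.

Lemma to_loc_ideal_expP J k a : GRing.submod_closed (J : {pred R^o}) ->
  (to_loc P a \in ideal_exp (loc_ideal P J) k) <->
  exists2 s, s \notin P & s * a \in ideal_exp J k.
Proof.
move=> Jcl; split=> [|[s sP Jsa]]; last first.
  by apply: (mem_loc_ideal_exp sP Jsa); rewrite rmorphM mulrC.
move=> /(loc_ideal_exp_numerator Jcl)[s sP [b Jb]].
(* Fractions agree only up to a factor [u] outside [P], so [s] alone need not suffice. *)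
rewrite -rmorphM => /to_loc_eq[u uP e]; exists (u * s).
  exact: Localization.mulP.
by rewrite -mulrA [s * a]mulrC e ideal_expMl.
Qed.

End LocalizedIdeals.

Lemma idealr_submod_closed (R : comNzRingType) (I : idealr R) :
  GRing.submod_closed (I : {pred R^o}).
Proof. by split=> [|c x y Ix Iy]; [exact: idealr0 | rewrite rpredD // idealMr]. Qed.

Theorem mainTheorem1 (R : comNzRingType) (I : idealr R) :
  noetherian R -> strong_persistence I -> persistence I.
Proof.
move=> _ spI k P /AssP[m mP]; apply/AssP.
(* For [x] in [I], the power [x ^+ k.+1] lies in I^(k+1), hence multiplies [m] into it and belongs
   to [P]; primality gives [x]. *)
have IP : {subset I <= P}.
  move=> x Ix; apply: (@prime_idealrX _ P x k.+1).
  by rewrite mP mulrC; apply/ideal_expMl/ideal_expX.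
have Icl := idealr_submod_closed I.
have [|||g /(loc_ideal_numerator Icl)[s sP [a Ia gs]] mgN] :=
    spI P IP k.+1 _ (to_loc P m).
- by [].
(* Write y = p/s with [p] in [P]; then m y = (p m)/s, and p m is in I^(k+1) by the choice of [m]. *)
- apply/asboolP => y /(loc_ideal_numerator (idealr_submod_closed P)).
  move=> [s sP [p pP ys]].
  have pm : p * m \in ideal_exp I k.+1 by rewrite -mP.
  by apply: (mem_loc_ideal_exp sP pm); rewrite -mulrA ys rmorphM mulrC.
(* Otherwise some [s] outside [P] would satisfy s m in I^(k+1), which forces [s] into [P]. *)
- by apply/negP => /(to_loc_ideal_expP _ _ _ Icl)[s /negP sP]; rewrite -mP.
exists (a * m) => t; apply/idP/idP => [tP | Itam].
  by rewrite mulrCA; apply: ideal_expSM; rewrite // -mP.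
apply: contraNT mgN => tP.
(* Here m g = (t a m)/(s t), a fraction with numerator in I^(k+2). *)
apply: (mem_loc_ideal_exp (Localization.mulP sP tP) Itam).
by rewrite !rmorphM -gs; ring.
Qed.
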